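(* For each positive integer $n$, there are exactly $\prod_{t=0}^{T_n}\left(\gamma^O_{n,t}!\right)$ representations of $S^*_n$ as a sum (pointwise on $(0,1)$) $$S^*_n=\sum_{i=1}^nR^*_{n,i},$$ where $(R^*_{n,i}\mid 1\le i\le n)$ is an i.i.d. family of random variables on $(0,1)$, each of which has the outcomes $o_1,\ldots,o_m$ of $O$ as values, with equal probability, has mean $0$, variance $1$, and depends only on $(\varepsilon_1(x),\ldots,\varepsilon_{n(M+1)}(x))$. Therefore, there exist (continuum many) strong trim triangular array representations of the sequence $\{S^*_n\}$.
   Context: Work in the probability space $(0,1)$ with Lebesgue measure. For $x\in(0,1)$ write $x=\sum_{i\ge1}\varepsilon_i(x)2^{-i}$ with $\varepsilon_i(x)\in\{0,1\}$ and $\varepsilon_i(x)=0$ for infinitely many $i$. Fix an integer $M\ge 0$, put $m=2^{M+1}$, and fix a random variable $O:(0,1)\to\mathbb{R}$ such that $O(x)$ depends bijectively on $(\varepsilon_1(x),\ldots,\varepsilon_{M+1}(x))$. Its $m$ distinct outcomes are enumerated increasingly as $o_1<\cdots<o_m$; they are equally likely, $\sum_s o_s=0$, and $O$ has variance $1$, i.e. $\sum_s o_s^2=m$. Let $\varsigma_s\in\{0,1\}^{M+1}$ be such that $O(x)=o_s$ iff $(\varepsilon_1(x),\ldots,\varepsilon_{M+1}(x))=\varsigma_s$. Arrange the positive integers consecutively, in increasing order, in rows indexed by $\rho=1,2,\ldots$, where row $\rho$ has length $b$, the unique positive integer with $(b-1)(M+1)<\rho\le b(M+1)$. Let $J_i$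 be the $i$-th column (the set of $i$-th entries of all rows of length $\ge i$), enumerated increasingly as $j_{i,1}<j_{i,2}<\cdots$. Let $P_i(x)$ be the number with $\varepsilon_k(P_i(x))=\varepsilon_{j_{i,k}}(x)$ for all $k$, and $R_i(x)=O(P_i(x))$; that is, for every $x\in(0,1)$, $R_i(x)=o_s$ iff $(\varepsilon_{j_{i,1}}(x),\ldots,\varepsilon_{j_{i,M+1}}(x))=\varsigma_s$. Put $S_n=\sum_{i=1}^n R_i$. The quantile $S^*_n$ of $S_n$ is $S^*_n(x)=\inf\{t\in\mathbb{R}\mid C(t)>x\}$ for $x\in(0,1)$, where $C$ is the cumulative distribution function of $S_n$. $\mathbf{K}_n$ is the set of $\vec k=(k_1,\ldots,k_m)$ of non-negative integers with sum $n$; $\binom{n}{\vec k}=\frac{n!}{k_1!\cdots k_m!}$; $\vec k\cdot\vec o=k_1o_1+\cdots+k_mo_m$. Let $(v_n^t\mid 0\le t\le T_n)$ be the increasing enumeration of the set of values $\{\vec k\cdot\vec o\mid\vec k\in\mathbf{K}_n\}$. For $0\le t\le T_n$, $\gamma^O_{n,t}=\sum\binom{n}{\vec k}$, the sum being over $\vec k\in\mathbf{K}_n$ with $\vec k\cdot\vec o=v_n^t$. A strong trim triangular array representation of $\{S^*_n\}$ is an array $(R^*_{n,i}\mid n\ge1,\ 1\le i\le n)$ of random variables on $(0,1)$ such that for each $n$, the row $(R^*_{n,i}\mid 1\le i\le n)$ is an i.i.d. family of random variables depending only on $(\varepsilon_1(x),\ldots,\varepsilon_{n(M+1)}(x))$,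 each with mean $0$, variance $1$ and with the outcomes $o_1,\ldots,o_m$ of $O$ as values with equal probability, and $S^*_n=\sum_{i=1}^nR^*_{n,i}$ pointwise as functions on $(0,1)$. *)

(* Defs.v *)
From HB Require Import structures.
From mathcomp Require Import all_boot all_order all_algebra.
From mathcomp Require Import all_classical all_reals all_analysis.
From mathcomp Require Import measurable_realfun zify.

Set Implicit Arguments.
Unset Strict Implicit.
Unset Printing Implicit Defensive.

Import Order.TTheory GRing.Theory Num.Theory.
Import numFieldNormedType.Exports.

Local Open Scope classical_set_scope.
Local Open Scope ring_scope.

(* The interval (0,1) is a type of its own, so that equality of random
   variables is equality of functions on (0,1).  It carries the trace of the
   Borel sigma-algebra of R. *)
Definition I01 (R : realType) : Type := {x : R | 0 < x < 1}.

Definition I01_val (R : realType) (x : I01 R) : R := sval x.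
Coercion I01_val : I01 >-> Real.sort.

Lemma half_in_I01 (R : realType) : 0 < (2^-1 : R) < 1.
Proof. by rewrite invr_gt0 ltr0n /= invf_lt1 ?ltr1n ?ltr0n. Qed.

HB.instance Definition _ (R : realType) := gen_eqMixin (I01 R).
HB.instance Definition _ (R : realType) := gen_choiceMixin (I01 R).
HB.instance Definition _ (R : realType) :=
  isPointed.Build (I01 R) (exist _ 2^-1 (half_in_I01 R)).
HB.instance Definition _ (R : realType) :=
  Measurable.copy (I01 R) (g_sigma_algebra_preimageType (@I01_val R)).

Lemma I01_val_inj (R : realType) : injective (@I01_val R).
Proof. exact: val_inj. Qed.

Lemma range_I01_val (R : realType) : range (@I01_val R) = `]0, 1[%classic.
Proof.
apply/seteqP; split=> [_ [x _ <-]|x] /=; rewrite in_itv /=; first exact: (svalP x).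
by move=> x01; exists (exist _ x x01).
Qed.

Lemma measurable_image_I01_val (R : realType) (A : set (I01 R)) :
  measurable A -> measurable (@I01_val R @` A).
Proof.
case=> B mB <-; rewrite setTI.
rewrite (_ : _ @` _ = `]0, 1[%classic `&` B); first exact: measurableI.
rewrite -range_I01_val; apply/seteqP; split=> [_ [x Bx <-]|_ [[x _ <-] Bx]].
  by split=> //; exists x.
by exists x.
Qed.

Definition leb01 (R : realType) (A : set (I01 R)) : \bar R :=
  lebesgue_measure (@I01_val R @` A).

Lemma leb01_0 (R : realType) : @leb01 R set0 = 0%E.
Proof. by rewrite /leb01 image_set0 measure0. Qed.

Lemma leb01_ge0 (R : realType) (A : set (I01 R)) : (0 <= leb01 A)%E.
Proof. exact: measure_ge0. Qed.

Lemma leb01_semi_sigma_additive (R : realType) :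
  semi_sigma_additive (@leb01 R).
Proof.
move=> F mF tF mUF; rewrite /leb01 image_bigcup.
apply: measure_semi_sigma_additive.
- by move=> i; exact: measurable_image_I01_val.
- apply/trivIsetP => i j _ _ ij.
  move/trivIsetP : tF => /(_ i j Logic.I Logic.I ij) Fij.
  rewrite -subset0 => _ [[x Fix <-] [y Fjy /I01_val_inj yx]].
  by rewrite yx in Fjy; have : (F i `&` F j) x by []; rewrite Fij.
- by rewrite -image_bigcup; exact: measurable_image_I01_val.
Qed.

HB.instance Definition _ (R : realType) := isMeasure.Build _ _ _ (@leb01 R)
  (leb01_0 R) (@leb01_ge0 R) (@leb01_semi_sigma_additive R).

Lemma leb01_setT (R : realType) : @leb01 R setT = 1%E.
Proof.
by rewrite /leb01 range_I01_val lebesgue_measure_itv /= lte01 sube0.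
Qed.

HB.instance Definition _ (R : realType) :=
  Measure_isProbability.Build _ _ _ (@leb01 R) (leb01_setT R).

Definition lebP (R : realType) : probability (I01 R) R := @leb01 R.

(* Digits are indexed from 1; the value [e 0] is irrelevant. *)
Definition binary_expansion (R : realType) (x : R) (e : nat -> bool) : Prop :=
  ((fun N => \sum_(1 <= i < N.+1) (e i)%:R * 2^-1 ^+ i) @ \oo --> x) /\
  (forall N, exists2 i, (N <= i)%N & e i = false).

Definition digit (R : realType) (x : I01 R) : nat -> bool :=
  get [set e | binary_expansion (x : R) e].

Lemma digitP (R : realType) (x : I01 R) :
  binary_expansion (x : R) (digit x).
Proof.
apply: (@getPex _ [set e | binary_expansion (x : R) e]).
have /andP[] : 0 < I01_val x < 1 by exact: (svalP x).
move: (I01_val x) => {}x x0 x1.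
pose f i := Num.truncn (x * 2 ^+ i).
have fP i : (f i)%:R <= x * 2 ^+ i < (f i).+1%:R.
  by apply: truncn_itv; rewrite mulr_ge0 ?exprn_ge0 ?ltW.
have fS i : f i.+1 = (odd (f i.+1) + (f i).*2)%N.
  suff /eqP <- : (f i.+1)./2 == f i by rewrite odd_double_half.
  have /andP[l u] := fP i; have /andP[l' u'] := fP i.+1.
  rewrite exprS mulrCA in l' u'.
  have ul : (f i.+1 < (f i).+1.*2)%N.
    rewrite -(ltr_nat R); apply: le_lt_trans l' _.
    by rewrite -mul2n natrM ltr_pM2l.
  have lu : ((f i).*2 < (f i.+1).+1)%N.
    rewrite -(ltr_nat R); apply: le_lt_trans u'.
    by rewrite -mul2n natrM ler_pM2l.
  by rewrite eqn_leq leq_half_double geq_half_double -ltnS; apply/andP; split; lia.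
have f0 : f 0 = 0%N.
  apply/eqP; rewrite -leqn0 -ltnS -(ltr_nat R).
  by have /andP[l _] := fP 0%N; apply: le_lt_trans l _; rewrite expr0 mulr1.
have sumE N : \sum_(1 <= i < N.+1) (odd (f i))%:R * 2^-1 ^+ i =
              (f N)%:R * 2^-1 ^+ N :> R.
  elim: N => [|N IH]; first by rewrite big_geq // f0 mul0r.
  rewrite big_nat_recr //= IH.
  have -> : (f N.+1)%:R = (odd (f N.+1))%:R + (f N)%:R * 2 :> R.
    by rewrite {1}fS natrD -muln2 natrM.
  rewrite mulrDl addrC; congr (_ + _).
  by rewrite exprS mulrA mulfK.
have half N : 2 ^+ N * 2^-1 ^+ N = 1 :> R by rewrite -exprMn divff ?expr1n.
have hN N : 0 < 2^-1 ^+ N :> R by rewrite exprn_gt0.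
have bnd N : (f N)%:R * 2^-1 ^+ N <= x < (f N)%:R * 2^-1 ^+ N + 2^-1 ^+ N.
  have /andP[l u] := fP N; have xN : x = x * 2 ^+ N * 2^-1 ^+ N.
    by rewrite -mulrA half mulr1.
  rewrite -[X in _ + X]mul1r -mulrDl natr1 xN.
  by rewrite ler_pM2r // ltr_pM2r // l.
have cvg0 : (fun N => (2^-1 : R) ^+ N) @ \oo --> (0 : R).
  by apply: cvg_expr; rewrite ger0_norm // invf_lt1 // ltr1n.
exists (fun i => odd (f i)); split=> [|N].
  under eq_fun do rewrite sumE.
  apply: (@squeeze_cvgr _ _ _ _ (fun N => x - (2^-1 : R) ^+ N) (fun=> x)).
  - apply: nearW => N; have /andP[l u] := bnd N.
    by rewrite l andbT lerBlDr ltW.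
  - by rewrite -[X in _ --> X]subr0; apply: cvgB => //; exact: cvg_cst.
  - exact: cvg_cst.
apply: contrapT => H.
have odd1 i : (N <= i)%N -> odd (f i).
  by move=> Ni; apply: contrapT => /negP/negbTE oi; apply: H; exists i.
have fNk k : ((f (N + k)).+1 = (f N).+1 * 2 ^ k)%N.
  elim: k => [|k IH]; first by rewrite addn0 expn0 muln1.
  have := fS (N + k)%N; rewrite odd1 ?leqW ?leq_addr // addnS => ->.
  by rewrite add1n -doubleS IH -muln2 expnSr mulnA.
have xle k : (f N).+1%:R * 2^-1 ^+ N - 2^-1 ^+ (N + k) <= x.
  have /andP[+ _] := bnd (N + k)%N; apply: le_trans.
  rewrite lerBlDr -[X in _ + X]mul1r -mulrDl natr1 fNk natrM natrX exprD.
  by rewrite mulrACA half mulr1.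
suff : (f N).+1%:R * 2^-1 ^+ N <= x.
  by rewrite leNgt; have /andP[_] := bnd N; rewrite -[(f N).+1%:R]natr1 mulrDl mul1r => ->.
apply: (@cvgr_to_le nat \oo _ R
  (fun k => (f N).+1%:R * 2^-1 ^+ N - 2^-1 ^+ (N + k))).
  rewrite -[X in _ --> X]subr0; apply: cvgB; first exact: cvg_cst.
  under eq_fun do rewrite addnC.
  by move: cvg0; rewrite -(cvg_shiftn N).
exact: nearW.
Qed.

Definition first_digits (R : realType) (n : nat) (x : I01 R) : n.-tuple bool :=
  [tuple digit x k.+1 | k < n].

Definition depends_only_on_digits (R : realType) (T : Type) (n : nat)
    (X : I01 R -> T) : Prop :=
  forall x y : I01 R,
    (forall k, (0 < k <= n)%N -> digit x k = digit y k) -> X x = X y.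

Definition depends_bijectively_on_digits (R : realType) (n : nat)
    (X : I01 R -> R) : Prop :=
  exists2 h : n.-tuple bool -> R,
    injective h & forall x, X x = h (first_digits n x).

(* The positive integers are arranged consecutively in rows [rho = 1, 2, ...]
   of length [row_length M rho]; [row_entry M rho i] is the [i]-th entry,
   [i >= 1], of row [rho]. *)
Definition row_length (M rho : nat) : nat := (rho.-1 %/ M.+1).+1.

Lemma row_lengthP (M rho b : nat) : (0 < rho)%N ->
  (0 < b)%N && (b.-1 * M.+1 < rho <= b * M.+1)%N = (b == row_length M rho).
Proof.
case: rho b => // r [|b] _ //=.
by rewrite /row_length /= eqSS eqn_leq leq_divRL // -[(r %/ _ <= b)%N]ltnS ltn_divLR.
Qed.

Definition row_entry (M rho i : nat) : nat :=
  (\sum_(1 <= r < rho) row_length M r + i)%N.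

Definition column (M i : nat) : set nat :=
  [set a | exists rho,
     [/\ (0 < rho)%N, (i <= row_length M rho)%N & a = row_entry M rho i]].

(* Positions are indexed from 1, as are the columns. *)
Definition increasing_enumeration (J : set nat) (j : nat -> nat) : Prop :=
  (forall k l, (0 < k < l)%N -> (j k < j l)%N) /\
  j @` [set k | (0 < k)%N] = J.

Definition column_entry (M i : nat) : nat -> nat :=
  get (increasing_enumeration (column M i)).

Lemma column_entryP (M i : nat) : (0 < i)%N ->
  increasing_enumeration (column M i) (column_entry M i).
Proof.
move=> i0; apply: (@getPex _ (increasing_enumeration (column M i))).
exists (fun k => row_entry M (i.-1 * M.+1 + k) i); split=> [k l /andP[k0 kl]|].
  rewrite /row_entry ltn_add2r.
  rewrite [ltnRHS](@big_cat_nat _ _ _ (i.-1 * M.+1 + k)) /=; first last.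
  - by rewrite leq_add2l ltnW.
  - by rewrite addn_gt0 k0 orbT.
  rewrite -[ltnLHS]addn0 ltn_add2l big_ltn ?ltn_add2l//.
apply/seteqP; split=> [_ /= [k k0 <-]|a [rho [rho0 irho ->]]] /=.
  exists (i.-1 * M.+1 + k)%N; split=> //; first by rewrite addn_gt0 k0 orbT.
  case: i i0 k k0 => // i _ [//|k] _ /=.
  by rewrite /row_length addnS ltnS /= leq_divRL // leq_addr.
have irho' : (i.-1 * M.+1 < rho)%N.
  case: i i0 rho rho0 irho => // i _ [//|r] _ /=.
  by rewrite /row_length !ltnS leq_divRL.
by exists (rho - i.-1 * M.+1)%N; [rewrite subn_gt0|rewrite subnKC // ltnW].
Qed.

Definition column_digits (R : realType) (M i : nat) (x : I01 R) :
    M.+1.-tuple bool :=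
  [tuple digit x (column_entry M i k.+1) | k < M.+1].

Section random_variables.
Context d (T : measurableType d) (R : realType) (P : probability T R).

Definition mutually_independent (I : finType) (X : I -> {RV P >-> R}) : Prop :=
  forall (J : {set I}) (B : I -> set R), (forall i, measurable (B i)) ->
    P (\bigcap_(i in [set` J]) (X i @^-1` B i)) =
    (\prod_(i in J) P (X i @^-1` B i))%E.

Definition identically_distributed (I : finType) (X : I -> {RV P >-> R}) :
    Prop :=
  forall (i j : I) (B : set R), measurable B ->
    distribution P (X i) B = distribution P (X j) B.

Definition uniform_on_outcomes (m : nat) (o : 'I_m -> R) (X : {RV P >-> R}) :
    Prop :=
  range X = range o /\ forall s, P (X @^-1` [set o s]) = (m%:R^-1)%:E.

(* For [0 < x < 1] the set below is nonempty and bounded from below, so that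
   the total operation [inf] is the actual infimum. *)
Definition quantile (X : {RV P >-> R}) (x : R) : R :=
  inf [set t | (x%:E < cdf X t)%E].

End random_variables.

(* [{RV _ >-> _}] is a copy of [{mfun _ >-> _}] without its ring structure. *)
Definition partial_sum (R : realType) (X : nat -> {mfun I01 R >-> R})
    (n : nat) : {RV (lebP R) >-> R} := \sum_(1 <= i < n.+1) X i.

Definition multi_index (m n : nat) : {set {ffun 'I_m -> 'I_n.+1}} :=
  [set k : {ffun 'I_m -> 'I_n.+1} | (\sum_s k s == n)%N].

Definition multinomial (m n : nat) (k : {ffun 'I_m -> 'I_n.+1}) : nat :=
  (n`! %/ \prod_s (k s)`!)%N.

Definition dot (R : realType) (m n : nat) (o : 'I_m -> R)
    (k : {ffun 'I_m -> 'I_n.+1}) : R := \sum_s (k s)%:R * o s.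

(* The increasing enumeration v_n^0 < ... < v_n^{T_n}. *)
Definition sum_values (R : realType) (m : nat) (o : 'I_m -> R) (n : nat) :
    seq R :=
  sort <=%R (undup [seq dot o k | k in multi_index m n]).

Definition last_index (R : realType) (m : nat) (o : 'I_m -> R) (n : nat) : nat :=
  (size (sum_values o n)).-1.

Definition gamma_ (R : realType) (m : nat) (o : 'I_m -> R) (n t : nat) : nat :=
  (\sum_(k in multi_index m n | dot o k == nth 0%R (sum_values o n) t)
     multinomial k)%N.

Definition trim_row (R : realType) (M : nat) (o : 'I_(2 ^ M.+1) -> R)
    (n : nat) (S : I01 R -> R) (X : 'I_n -> {RV (lebP R) >-> R}) : Prop :=
  [/\ mutually_independent X /\ identically_distributed X,
      forall i, depends_only_on_digits (n * M.+1) (X i),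
      forall i, ('E_(lebP R)[X i] = 0 /\ 'V_(lebP R)[X i] = 1)%E,
      forall i, uniform_on_outcomes o (X i)
    & forall x, S x = \sum_(i < n) X i x].

(* There is exactly one row for [n = 0], as ['I_0] is empty. *)
Definition trim_array (R : realType) (M : nat) (o : 'I_(2 ^ M.+1) -> R)
    (S : nat -> I01 R -> R) (X : forall n, 'I_n -> {RV (lebP R) >-> R}) :
    Prop :=
  forall n, (0 < n)%N -> trim_row o (S n) (X n).

(* Main.v *)
Require Import Defs.
From mathcomp Require Import all_boot all_order all_algebra.
From mathcomp Require Import all_fingroup.
From mathcomp Require Import all_classical all_reals all_analysis.
From mathcomp Require Import measurable_realfun zify.

(** Fix [n] and put [m = 2 ^ M.+1], [L = n * M.+1].  Let [F] be the set of
    words [f : 'I_n -> 'I_m], and give a word the value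
    [outcome_sum o f = \sum_i o (f i)].  There are [m ^ n = 2 ^ L] words, as
    many as there are dyadic cells of order [L] in (0,1), and every probability
    in the statement comes from a map of (0,1) to a finite set whose fibres all
    have the same measure, a [uniform_map].

    - The columns are disjoint sets of positions, and digits at distinct
      positions are uniform ([digits_at_uniform]).  Hence the word read off the
      first [n] columns is uniform on [F] ([column_digits_uniform]), and the
      [n]-th partial sum is the value of a uniform random word.
    - Consequently the quantile function lists the values of the words in
      nondecreasing order along the [2 ^ L] dyadic cells: if [Phi x] is the
      word whose rank is the number of the cell of [x], words being sorted by
      value, then the quantile at [x] is the value of [Phi x]
      ([quantile_rearranged]).
    - A row of variables with values among the outcomes is a map [Psi] from
      (0,1) to [F].  It depends on the first [L] digits only when it is constant
      on the cells, and it is independent and uniform exactly when [Psi] is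
      uniform on [F], that is, when it takes every word on exactly one cell.  So
      [Psi] is [Phi] followed by a permutation [p] of [F]; the row sums to the
      quantile exactly when [p] preserves the values of the words
      ([trim_row_permuted]).
    - Permutations that preserve a colouring permute each colour class
      separately, so there are as many of them as the product of the factorials
      of the sizes of the classes ([card_colour_perms]).  Here the class of the
      [t]-th value has [gamma_ o n t] elements ([gamma_card]), since the words
      with prescribed numbers of occurrences are counted by a multinomial
      coefficient; this last fact is again an orbit count under the
      permutations of ['I_n], whose stabilizers are colour preserving.

    For the arrays, one chooses a row for each [n] independently.  There are
    finitely many rows for each [n], and at least two when [n >= 2] because
    exchanging the first two variables of a row gives a different one; a
    countable product of such sets has the cardinality of the continuum
    ([countable_product_continuum]). *)

Set Implicit Arguments.
Unset Strict Implicit.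
Unset Printing Implicit Defensive.

Import Order.TTheory GRing.Theory Num.Theory.
Import numFieldNormedType.Exports.

Local Open Scope classical_set_scope.
Local Open Scope card_scope.
Local Open Scope ring_scope.

(** * Permutations preserving a colouring *)

Section ColourPreservingPermutations.
Local Open Scope group_scope.
Variables (T : finType) (U : eqType) (c : T -> U).

(** Colour-preserving permutations that move only points whose colour is listed;
    the list of colours is what the counting induction runs over. *)
Definition colour_perms_within (vs : seq U) : {set {perm T}} :=
  [set p : {perm T} |
    [forall x, (c (p x) == c x) && ((c x \notin vs) ==> (p x == x))]].

Lemma colour_perms_withinP vs (p : {perm T}) :
  reflect (forall x, c (p x) = c x /\ (c x \notin vs -> p x = x))
          (p \in colour_perms_within vs).
Proof.
rewrite inE; apply: (iffP forallP) => H x; have := H x.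
  by case/andP=> /eqP-> /implyP h; split=> // /h /eqP.
by case=> -> h; rewrite eqxx; apply/implyP => /h ->.
Qed.

Lemma group_set_colour_perms vs : group_set (colour_perms_within vs).
Proof.
apply/group_setP; split; first by apply/colour_perms_withinP => x; rewrite perm1.
move=> p q /colour_perms_withinP hp /colour_perms_withinP hq.
apply/colour_perms_withinP => x; rewrite permM; split.
  by rewrite (hq _).1 (hp _).1.
by move=> xvs; rewrite (hp x).2 // (hq x).2.
Qed.

Canonical colour_perms_group vs := Group (group_set_colour_perms vs).

(** Restricting a permutation to the class of colour [v] splits off a factor
    that moves this class only; the cofactor fixes the class pointwise. *)
Lemma colour_perms_within_cons v vs : v \notin vs ->
  colour_perms_within (v :: vs) =
  colour_perms_within [:: v] * colour_perms_within vs.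
Proof.
move=> vvs; pose A := [set x | c x == v]%SET.
apply/finset.setP => p; apply/idP/mulsgP => [/colour_perms_withinP hp|[q r]]; last first.
  move=> /colour_perms_withinP hq /colour_perms_withinP hr ->.
  apply/colour_perms_withinP => x; rewrite permM (hr _).1 (hq _).1; split=> //.
  rewrite inE negb_or => /andP[xv xvs].
  by rewrite (hq x).2 ?inE // (hr x).2.
have pA : p \in 'N(A | 'P).
  by apply/astabsP => x; rewrite !inE /= apermE (hp x).1.
pose q := restr_perm A p.
have qA x : c x = v -> q x = p x.
  by move=> cx; rewrite /q restr_permE // inE cx.
have qN x : c x <> v -> q x = x.
  move=> cx; apply: (out_perm (restr_perm_on A p)).
  by rewrite inE; apply/eqP.
have qK : q \in colour_perms_within [:: v].
  apply/colour_perms_withinP => x; split.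
    by have [cx|/eqP cx] := eqVneq (c x) v; [rewrite qA ?(hp x).1|rewrite qN].
  by rewrite inE => /eqP; apply: qN.
have qVK := groupVr qK.
exists q (q^-1 * p) => //; last by rewrite mulKVg.
apply/colour_perms_withinP => x; rewrite permM (hp _).1; split.
  by move/colour_perms_withinP: qVK => /(_ x)[].
move=> xvs; have [cx|/eqP cx] := eqVneq (c x) v.
  have cqx : c (q^-1 x) = v.
    by move/colour_perms_withinP: qVK => /(_ x)[->].
  by rewrite -qA // permKV.
have -> : q^-1 x = x by apply: (canLR (permK q)); rewrite qN.
by apply: (hp x).2; rewrite inE negb_or xvs andbT; apply/eqP.
Qed.

Lemma card_colour_perms1 v :
  #|colour_perms_within [:: v]| = #|[pred x | c x == v]| `!.
Proof.
have -> : #|[pred x | c x == v]| = #|[set x | c x == v]%SET|.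
  by apply: eq_card => x; rewrite !inE.
rewrite -card_perm; apply: eq_card => p; apply/colour_perms_withinP/idP => [hp|].
  apply/fintype.subsetP => x; rewrite !inE; apply: contraR => cx.
  by apply/eqP; apply: (hp x).2; rewrite inE.
move=> hp x; have [cx|cx] := boolP (x \in [set x | c x == v]%SET).
  have : p x \in [set x | c x == v]%SET by rewrite perm_closed.
  by move: cx; rewrite !inE => /eqP -> /eqP ->; rewrite eqxx.
by rewrite (out_perm hp).
Qed.

Lemma card_colour_perms_within vs : uniq vs ->
  #|colour_perms_within vs| = (\prod_(v <- vs) #|[pred x | c x == v]| `!)%N.
Proof.
elim: vs => [_|v vs IH /= /andP[vvs /IH {}IH]].
  rewrite big_nil -(cards1 (1 : {perm T})); apply: eq_card => p.
  rewrite [RHS]inE; apply/colour_perms_withinP/eqP => [hp|-> x]; last by rewrite perm1.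
  by apply/permP => x; rewrite perm1; apply: (hp x).2.
rewrite big_cons -IH -card_colour_perms1 colour_perms_within_cons // TI_cardMg //.
apply/trivgP/fintype.subsetP => p /finset.setIP[].
move=> /colour_perms_withinP hp /colour_perms_withinP hq.
apply/finset.set1P/permP => x; rewrite perm1.
have [cx|cx] := eqVneq (c x) v; first by apply: (hq x).2; rewrite cx.
by apply: (hp x).2; rewrite inE.
Qed.

Definition colour_perms : {set {perm T}} :=
  [set p : {perm T} | [forall x, c (p x) == c x]].

Lemma colour_permsP (p : {perm T}) :
  reflect (forall x, c (p x) = c x) (p \in colour_perms).
Proof. by rewrite inE; apply: (iffP forallP) => h x; apply/eqP/h. Qed.

Lemma card_colour_perms vs : uniq vs -> (forall x, c x \in vs) ->
  #|colour_perms| = (\prod_(v <- vs) #|[pred x | c x == v]| `!)%N.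
Proof.
move=> uvs cvs; rewrite -card_colour_perms_within //; apply: eq_card => p.
apply/colour_permsP/colour_perms_withinP => h x; last exact: (h x).1.
by rewrite h cvs.
Qed.

End ColourPreservingPermutations.

(** * Words with prescribed numbers of occurrences *)

Section Multinomial.
Variables m n : nat.
Implicit Types f : {ffun 'I_n -> 'I_m}.

Definition occurrences f (s : 'I_m) : nat := #|[pred i | f i == s]|.

Lemma occurrences_count f s :
  occurrences f s = count_mem s [tuple f i | i < n].
Proof.
rewrite /occurrences cardE size_filter /= count_map enumT.
by apply: eq_count.
Qed.

Lemma sum_occurrences f : (\sum_s occurrences f s = n)%N.
Proof.
under eq_bigr do rewrite /occurrences -sum1_card.
rewrite -[RHS]card_ord -sum1_card (partition_big f predT) //=.
Qed.

Lemma perm_eq_occurrences f g : (forall s, occurrences f s = occurrences g s) ->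
  perm_eq [tuple f i | i < n] [tuple g i | i < n].
Proof.
move=> fg; apply/allP => s _ /=.
by rewrite -!occurrences_count fg.
Qed.

(** Permuting positions acts transitively on the words with given numbers of
    occurrences, and the stabilizer of a word is the group of permutations that
    preserve it as a colouring of the positions. *)
Lemma card_same_occurrences f0 :
  (#|[pred f | [forall s, occurrences f s == occurrences f0 s]]|
     * \prod_s (occurrences f0 s)`! = n`!)%N.
Proof.
pose g (p : 'S_n) : {ffun 'I_n -> 'I_m} := [ffun i => f0 (p i)].
have occE p s : occurrences (g p) s = occurrences f0 s.
  rewrite /occurrences -[LHS]cardsE -[RHS]cardsE -[RHS](card_preimset _ (@perm_inj _ p)).
  by apply: eq_card => i; rewrite !inE ffunE.
have gP f : [forall s, occurrences f s == occurrences f0 s] ->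
    exists p, g p = f.
  move=> /forallP/= fE.
  have /tuple_permP[p pE] : perm_eq [tuple f i | i < n] [tuple f0 i | i < n].
    by apply: perm_eq_occurrences => s; apply/eqP.
  exists p; apply/ffunP => i; rewrite ffunE.
  have := congr1 (fun t => tnth t i) (val_inj pE).
  by rewrite !tnth_mktuple.
rewrite -[RHS]card_Sn -[RHS]sum1_card (partition_big g
  [pred f | [forall s, occurrences f s == occurrences f0 s]]) /=; last first.
  by move=> p _; apply/forallP => s; rewrite occE.
rewrite -sum_nat_const; apply: eq_bigr => f /gP[p0 <-].
(* The permutations that [g] sends to [g p0] form a coset of the stabilizer. *)
have -> : (\prod_s (occurrences f0 s)`! = #|colour_perms f0|)%N.
  rewrite (@card_colour_perms _ _ f0 (enum 'I_m)) ?enum_uniq //; last first.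
    by move=> x; rewrite mem_enum.
  by rewrite big_enum.
rewrite -(card_lcoset _ p0) sum1_card; apply: eq_card => p.
rewrite mem_lcoset -[RHS]/(g p == g p0).
apply/colour_permsP/eqP => [h|/ffunP h x].
  by apply/ffunP => i; rewrite !ffunE -[RHS]h permM permK.
by have := h (p0^-1 x)%g; rewrite !ffunE permKV permM => ->.
Qed.

Lemma exists_occurrences (k : 'I_m -> nat) : (\sum_s k s = n)%N ->
  exists f, forall s, occurrences f s = k s.
Proof.
move=> kn; pose w := flatten [seq nseq (k s) s | s <- enum 'I_m].
have szw : size w == n.
  rewrite size_flatten /shape -map_comp sumnE big_map big_enum /= -[X in _ == X]kn.
  by apply/eqP; apply: eq_bigr => s _ /=; rewrite size_nseq.
exists [ffun i => tnth (Tuple szw) i] => s; rewrite occurrences_count.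
have -> : [tuple [ffun i => tnth (Tuple szw) i] i | i < n] = w :> seq _.
  rewrite -[RHS]/(tval (Tuple szw)); congr tval; apply: eq_from_tnth => i.
  by rewrite tnth_mktuple ffunE.
rewrite /w count_flatten -map_comp sumnE big_map big_enum /= (bigD1 s) //=.
rewrite count_nseq /= eqxx mul1n big1 ?addn0 // => t ts.
by rewrite count_nseq /= (negbTE ts) mul0n.
Qed.
End Multinomial.

Section SumValues.
Variables (R : realType) (m : nat) (o : 'I_m -> R) (n : nat).
Implicit Types f : {ffun 'I_n -> 'I_m}.

Definition outcome_sum f : R := \sum_i o (f i).

Definition occurrence_vector f : {ffun 'I_m -> 'I_n.+1} :=
  [ffun s => inord (occurrences f s)].

Lemma occurrence_vectorE f s : occurrence_vector f s = occurrences f s :> nat.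
Proof.
rewrite ffunE inordK // ltnS -{2}(sum_occurrences f) (bigD1 s) //=.
exact: leq_addr.
Qed.

Lemma occurrence_vector_multi_index f : occurrence_vector f \in multi_index m n.
Proof.
rewrite inE; apply/eqP; rewrite -[RHS](sum_occurrences f).
by apply: eq_bigr => s _; rewrite occurrence_vectorE.
Qed.

Lemma outcome_sum_dot f : outcome_sum f = dot o (occurrence_vector f).
Proof.
rewrite /outcome_sum /dot (partition_big f predT) //=; apply: eq_bigr => s _.
rewrite (eq_bigr (fun=> o s)) => [|i /eqP -> //].
by rewrite occurrence_vectorE sumr_const mulr_natl.
Qed.

Lemma multi_index_occurrence_vector k : k \in multi_index m n ->
  exists f, occurrence_vector f = k.
Proof.
rewrite inE => /eqP /exists_occurrences[f fk].
by exists f; apply/ffunP => s; apply: val_inj; rewrite /= occurrence_vectorE.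
Qed.

Lemma card_occurrence_vector k : k \in multi_index m n ->
  #|[pred f | occurrence_vector f == k]| = multinomial k.
Proof.
move=> /multi_index_occurrence_vector[f0 <-]; rewrite /multinomial.
under eq_bigr do rewrite occurrence_vectorE.
rewrite -(card_same_occurrences f0) mulnK; last first.
  by rewrite prodn_gt0 // => s; rewrite fact_gt0.
apply: eq_card => f; rewrite !inE; apply/eqP/forallP => [fE s|fE].
  by rewrite -!occurrence_vectorE fE.
by apply/ffunP => s; apply: val_inj; rewrite /= !occurrence_vectorE; apply/eqP.
Qed.

(** Sorting the words of a given value by their occurrence vectors. *)
Lemma gamma_card t :
  gamma_ o n t = #|[pred f | outcome_sum f == nth 0 (sum_values o n) t]|.
Proof.
rewrite -[RHS]sum1_card (partition_big occurrence_vector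
  [pred k | k \in multi_index m n & dot o k == nth 0 (sum_values o n) t]) /=.
  apply: eq_bigr => k /andP[kn /eqP kv].
  rewrite -card_occurrence_vector // -sum1_card; apply: eq_bigl => f.
  rewrite !inE; have [fk|] := eqVneq (occurrence_vector f) k; last by rewrite andbF.
  by rewrite andbT outcome_sum_dot fk kv eqxx.
by move=> f; rewrite inE outcome_sum_dot occurrence_vector_multi_index.
Qed.

Lemma sum_values_uniq : uniq (sum_values o n).
Proof. by rewrite sort_uniq undup_uniq. Qed.

Lemma mem_sum_values f : outcome_sum f \in sum_values o n.
Proof.
rewrite mem_sort mem_undup outcome_sum_dot.
by apply: fintype.image_f; exact: occurrence_vector_multi_index.
Qed.

Lemma card_sum_preserving_perms f : #|colour_perms outcome_sum| =
  (\prod_(0 <= t < (last_index o n).+1) (gamma_ o n t)`!)%N.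
Proof.
rewrite (card_colour_perms sum_values_uniq mem_sum_values) (big_nth 0).
rewrite /last_index prednK; last by move: (mem_sum_values f); case: sum_values.
by apply: eq_bigr => t _; rewrite gamma_card.
Qed.
End SumValues.

(** * Maps to finite sets with equiprobable fibres *)

Section UniformMaps.
Context d (S : measurableType d) (R : realType) (P : probability S R).
Implicit Types T U : finType.

Definition uniform_map T (Phi : S -> T) : Prop :=
  forall t, measurable (Phi @^-1` [set t]) /\
            P (Phi @^-1` [set t]) = (#|T|%:R^-1)%:E.

Lemma preimage_bigcup_fibres T (Phi : S -> T) (A : pred T) :
  [set x | A (Phi x)] = \bigcup_(t in [set` A]) (Phi @^-1` [set t]).
Proof.
by apply/seteqP; split=> [x Ax|x [t At /= ->]] //; exists (Phi x).
Qed.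

Lemma trivIset_fibres T (Phi : S -> T) (D : set T) :
  trivIset D (fun t => Phi @^-1` [set t]).
Proof. by move=> s t _ _ [x [/= -> ->]]. Qed.

Lemma uniform_map_measurable T (Phi : S -> T) (A : pred T) :
  uniform_map Phi -> measurable [set x | A (Phi x)].
Proof.
move=> uPhi; rewrite preimage_bigcup_fibres; apply: fin_bigcup_measurable.
  exact: finite_finset.
by move=> t _; exact: (uPhi t).1.
Qed.

Lemma uniform_map_prob T (Phi : S -> T) (A : pred T) :
  uniform_map Phi -> P [set x | A (Phi x)] = (#|A|%:R / #|T|%:R)%:E.
Proof.
move=> uPhi; rewrite preimage_bigcup_fibres measure_fin_bigcup //=.
- rewrite (eq_fsbigr (fun=> (#|T|%:R^-1)%:E)); last by move=> t _; exact: (uPhi t).2.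
  have -> : [set` A] = [set` enum A].
    by apply/seteqP; split=> t /=; rewrite mem_enum.
  rewrite -fsbig_seq ?enum_uniq // sumEFin big_enum /= sumr_const.
  by rewrite mulr_natl.
- exact: trivIset_fibres.
- by move=> t _; exact: (uPhi t).1.
Qed.

Lemma uniform_map_card_gt0 T (Phi : S -> T) : (0 < #|T|)%N.
Proof.
apply/card_gt0P; have [x _] : [set: S] !=set0; last by exists (Phi x).
apply/set0P/eqP => S0; have := probability_setT P.
by rewrite S0 measure0 => /eqP; rewrite eq_sym onee_eq0.
Qed.

Lemma uniform_map_surj T (Phi : S -> T) :
  uniform_map Phi -> forall t, exists x, Phi x = t.
Proof.
move=> uPhi t; have [x] : Phi @^-1` [set t] !=set0; last by exists x.
apply/set0P/eqP => E; have := (uPhi t).2; rewrite E measure0 => /esym/eqP.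
by rewrite eqe invr_eq0 pnatr_eq0 -leqn0 leqNgt (uniform_map_card_gt0 Phi).
Qed.

(** The common size [c] of the fibres of [g] is forced to be [#|T| / #|U|]. *)
Lemma uniform_map_comp T U (Phi : S -> T) (g : T -> U) (c : nat) :
  uniform_map Phi -> (forall u, #|[pred t | g t == u]| = c) ->
  uniform_map (g \o Phi).
Proof.
move=> uPhi gc u.
have -> : (g \o Phi) @^-1` [set u] = [set x | [pred t | g t == u] (Phi x)].
  by apply/seteqP; split=> x /= /eqP.
split; first exact: uniform_map_measurable.
rewrite uniform_map_prob // gc.
have TU : #|T| = (#|U| * c)%N.
  rewrite -sum1_card (partition_big g predT) //= -sum_nat_const.
  by apply: eq_bigr => v _; rewrite sum1_card -(gc v).
have := uniform_map_card_gt0 Phi; rewrite TU muln_gt0 => /andP[U0 c0].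
by rewrite natrM invfM mulrCA divff ?mulr1 // pnatr_eq0 -lt0n.
Qed.

(** Uniformity depends only on the partition into fibres; this moves it between
    cells, digits and words without describing the bijections. *)
Lemma uniform_map_transfer T U (Phi : S -> T) (Psi : S -> U) :
  uniform_map Phi -> #|U| = #|T| ->
  (forall x y, Psi x = Psi y <-> Phi x = Phi y) -> uniform_map Psi.
Proof.
move=> uPhi UT PsiPhi.
have [xs xsP] := choice (uniform_map_surj uPhi).
pose g := Psi \o xs.
have -> : Psi = g \o Phi.
  by apply/funext => x; apply/PsiPhi; rewrite xsP.
have ginj : injective g by move=> s t /PsiPhi; rewrite !xsP.
have gbij : bijective g by apply: inj_card_bij ginj _; rewrite UT.
apply: (uniform_map_comp (c := 1)) => // u; case: gbij => h gK hK.
rewrite -(card1 (h u)); apply: eq_card => t; rewrite !inE.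
by rewrite (can2_eq gK hK).
Qed.

Lemma uniform_map_measurable_fun T (Phi : S -> T) (g : T -> R) :
  uniform_map Phi -> measurable_fun setT (g \o Phi).
Proof.
move=> uPhi _ B mB; rewrite setTI.
have -> : (g \o Phi) @^-1` B = [set x | [pred t | g t \in B] (Phi x)].
  by apply/seteqP; split=> x /=; rewrite inE.
exact: uniform_map_measurable.
Qed.

Definition uniform_rv T (Phi : S -> T) (uPhi : uniform_map Phi) (g : T -> R) :
  {RV P >-> R} := mfun_Sub (mem_set (uniform_map_measurable_fun g uPhi)).

Lemma uniform_rvE T (Phi : S -> T) (uPhi : uniform_map Phi) (g : T -> R) x :
  uniform_rv uPhi g x = g (Phi x).
Proof. by []. Qed.

Lemma uniform_map_expectation T (Phi : S -> T) (g : T -> R) :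
  uniform_map Phi ->
  ('E_P[g \o Phi] = ((\sum_t g t) / #|T|%:R)%:E)%E.
Proof.
move=> uPhi; rewrite unlock.
have fT : \big[setU/set0]_(t <- enum T) (Phi @^-1` [set t]) = setT.
  rewrite -subTset => x _; rewrite -bigcup_seq /=; exists (Phi x) => //=.
  by rewrite mem_enum.
rewrite -fT integral_bigsetU_EFin ?enum_uniq //=.
- rewrite big_enum /= mulr_suml -sumEFin; apply: eq_bigr => t _.
  rewrite (eq_integral (cst (g t)%:E)); last by move=> x; rewrite inE /= => ->.
  rewrite integral_cst; last exact: (uPhi t).1.
  by have [_] := uPhi t => /= ->; rewrite EFinM.
- by move=> t; exact: (uPhi t).1.
- exact: trivIset_fibres.
- by rewrite fT; apply/measurable_EFinP; exact: uniform_map_measurable_fun.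
Qed.

End UniformMaps.

(** * Binary expansions and dyadic cells *)

Section BinaryExpansions.
Variable R : realType.
Implicit Types (e : nat -> bool) (N : nat).

(** The integer whose binary digits are [e 1], ..., [e N]. *)
Fixpoint dyadic_prefix e N : nat :=
  if N is N'.+1 then ((dyadic_prefix e N').*2 + e N)%N else 0%N.

Lemma dyadic_prefix_lt e N : (dyadic_prefix e N < 2 ^ N)%N.
Proof.
elim: N => // N IH /=; rewrite expnS mul2n.
by case: (e N.+1); lia.
Qed.

Lemma eq_dyadic_prefix e e' N :
  dyadic_prefix e N = dyadic_prefix e' N <->
  forall k, (0 < k <= N)%N -> e k = e' k.
Proof.
elim: N => [|N [IH1 IH2]] /=; first by split=> // _ [].
split=> [ee' k /andP[k0]|ee'].
  rewrite leq_eqVlt => /predU1P[->|kN].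
    by move/(congr1 odd): ee'; rewrite !oddD !odd_double /= !oddb.
  apply: IH1; last by rewrite k0.
  by move/(congr1 half): ee'; rewrite ![(_ + nat_of_bool _)%N]addnC !half_bit_double.
rewrite IH2 ?ee' ?leqnn // => k /andP[k0 kN].
by rewrite ee' // k0 leqW.
Qed.

Lemma digit_series_prefix e N :
  \sum_(1 <= i < N.+1) (e i)%:R * 2^-1 ^+ i =
  (dyadic_prefix e N)%:R * 2^-1 ^+ N :> R.
Proof.
elim: N => [|N IH]; first by rewrite big_geq // mul0r.
rewrite big_nat_recr //= IH natrD mulrDl; congr (_ + _).
by rewrite exprS mulrA -muln2 natrM mulfK.
Qed.

(** The partial sums increase to [x], while the partial sums plus [2 ^- N]
    decrease to [x], strictly so at each digit 0; as there are infinitely many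
    of those, the upper bound is strict. *)
Lemma binary_expansion_prefix (x : R) e N : binary_expansion x e ->
  (dyadic_prefix e N)%:R <= 2 ^+ N * x < (dyadic_prefix e N).+1%:R.
Proof.
move=> [xe e0].
pose lo k : R := (dyadic_prefix e k)%:R * 2^-1 ^+ k.
pose hi k : R := (dyadic_prefix e k).+1%:R * 2^-1 ^+ k.
have h0 k : 0 < 2^-1 ^+ k :> R by rewrite exprn_gt0.
have loS k : lo k <= lo k.+1.
  rewrite /lo exprS mulrA ler_pM2r //= ler_pdivlMr // -natrM ler_nat.
  by lia.
have hiS k : hi k.+1 <= hi k ?= iff e k.+1.
  split.
    rewrite /hi exprS mulrA ler_pM2r //= ler_pdivrMr // -natrM ler_nat.
    by case: (e k.+1); lia.
  rewrite /hi exprS mulrA (inj_eq (mulIf (lt0r_neq0 (h0 k)))).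
  rewrite -(inj_eq (mulIf (lt0r_neq0 (ltr0n R 2)))) divfK // -natrM eqr_nat /=.
  by case: (e k.+1); lia.
have xlo : lo @ \oo --> x.
  suff -> : lo = fun k => \sum_(1 <= i < k.+1) (e i)%:R * 2^-1 ^+ i by [].
  by apply/funext => k; rewrite digit_series_prefix.
have lox k : lo k <= x.
  rewrite -(cvg_lim _ xlo) //; apply: nondecreasing_cvgn_le.
    exact/nondecreasing_seqP.
  by apply/cvg_ex; exists x.
have hi_noninc : {homo hi : n k / (n <= k)%N >-> k <= n}.
  by apply/nonincreasing_seqP => k; exact: (hiS k).1.
have xhi k : x <= hi k.
  apply: (cvgr_to_le xlo); near=> j.
  apply: (@le_trans _ _ (hi j)).
    by rewrite ler_pM2r // ler_nat.
  by apply: hi_noninc; near: j; exact: nbhs_infty_ge.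
have xlt k : x < hi k.
  have [[|i] ki ei] := e0 k.+1; first by lia.
  apply: (le_lt_trans (xhi i.+1)); apply: (lt_le_trans _ (hi_noninc k i ki)).
  by rewrite (lt_leif (hiS i)) ei.
have h2 : 2 ^+ N * 2^-1 ^+ N = 1 :> R by rewrite -exprMn divff ?expr1n.
have := lox N; have := xlt N; rewrite /lo /hi.
rewrite -(ler_pM2l (exprn_gt0 N (ltr0n R 2))) -(ltr_pM2l (exprn_gt0 N (ltr0n R 2))).
by rewrite !(mulrCA (2 ^+ N)) h2 !mulr1 => -> ->.
Unshelve. all: by end_near. Qed.

Lemma binary_expansion_truncn (x : R) e N : binary_expansion x e ->
  Num.truncn (2 ^+ N * x) = dyadic_prefix e N.
Proof. by move=> /(binary_expansion_prefix N)/truncn_def. Qed.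

Lemma binary_expansion_inj (x : R) e e' :
  binary_expansion x e -> binary_expansion x e' ->
  forall k, (0 < k)%N -> e k = e' k.
Proof.
move=> xe xe' k k0; apply: (eq_dyadic_prefix e e' k).1; last by rewrite k0 /=.
by rewrite -(binary_expansion_truncn k xe) (binary_expansion_truncn k xe').
Qed.

Definition dyadic_cell N (x : I01 R) : nat := Num.truncn (2 ^+ N * (x : R)).

Lemma dyadic_cellE N x : dyadic_cell N x = dyadic_prefix (digit x) N.
Proof. exact: binary_expansion_truncn (digitP x). Qed.

Lemma dyadic_cell_lt N x : (dyadic_cell N x < 2 ^ N)%N.
Proof. by rewrite dyadic_cellE dyadic_prefix_lt. Qed.

Lemma dyadic_cell_bounds N (x : I01 R) :
  (dyadic_cell N x)%:R <= 2 ^+ N * (x : R) < (dyadic_cell N x).+1%:R.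
Proof. rewrite dyadic_cellE; exact: binary_expansion_prefix (digitP x). Qed.

Lemma eq_dyadic_cell N (x y : I01 R) :
  dyadic_cell N x = dyadic_cell N y <->
  forall k, (0 < k <= N)%N -> digit x k = digit y k.
Proof. by rewrite !dyadic_cellE; exact: eq_dyadic_prefix. Qed.

Definition dyadic_cell_ord N (x : I01 R) : 'I_(2 ^ N) :=
  Ordinal (dyadic_cell_lt N x).

(** A cell is a half-open interval of length [2 ^- N], except that the first one
    lacks its left end point 0. *)
Lemma dyadic_cell_uniform N : uniform_map (lebP R) (dyadic_cell_ord N).
Proof.
move=> k; have pN : 0 < 2 ^+ N :> R by rewrite exprn_gt0.
pose a : R := k%:R / 2 ^+ N; pose b : R := k.+1%:R / 2 ^+ N.
pose I := Interval (BSide (k != 0 :> nat) a) (BLeft b).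
have b1 : b <= 1 by rewrite /b ler_pdivrMr // mul1r -natrX ler_nat.
have a0 : 0 <= a by rewrite divr_ge0 // ltW.
have ab : a < b by rewrite ltr_pM2r ?invr_gt0 // ltr_nat.
have kP (x : I01 R) : dyadic_cell_ord N x = k <-> a <= (x : R) < b.
  rewrite /a /b ler_pdivrMr // ltr_pdivlMr // mulrC; split=> [<-|].
    exact: dyadic_cell_bounds.
  by move=> /truncn_def kE; apply: val_inj.
have mk : measurable (dyadic_cell_ord N @^-1` [set k]).
  exists `[a, b[%classic; first exact: measurable_itv.
  rewrite setTI; apply/seteqP; split=> x /=; rewrite in_itv /=.
    by move/kP.
  by move=> h; apply/kP.
split=> //; rewrite /lebP /= /leb01.
have -> : @I01_val R @` (dyadic_cell_ord N @^-1` [set k]) = [set` I].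
  apply/seteqP; split=> [_ [x /kP xk <-]|x].
    have /andP[x0 x1] := svalP x; move: xk => /andP[ax xb] /=.
    rewrite /I in_itv /= xb andbT.
    have [k0|k0] := eqVneq (k : nat) 0%N; last by [].
    by rewrite /a k0 mul0r.
  rewrite /= /I in_itv /= => /andP[ax xb].
  have x01 : 0 < x < 1.
    rewrite (lt_le_trans xb b1) andbT.
    have [k0|k0] := eqVneq (k : nat) 0%N.
      by move: ax; rewrite /a k0 eqxx mul0r.
    move: ax; rewrite k0; apply: lt_le_trans.
    by rewrite divr_gt0 // ltr0n lt0n.
  exists (exist _ x x01) => //; apply/kP => /=.
  rewrite xb andbT; move: ax; case: (_ != _) => //=; exact: ltW.
rewrite lebesgue_measure_itv /I /= lte_fin ab -EFinB; congr (_%:E).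
by rewrite /a /b -mulrBl -natrB // subSnn mul1r card_ord natrX.
Qed.

End BinaryExpansions.

(** * Digits at distinct positions, and columns *)

Section DigitsAtPositions.
Variable R : realType.

Lemma leading_digits_uniform N : uniform_map (lebP R)
  (fun x => [ffun j : 'I_N => digit x j.+1] : {ffun 'I_N -> bool}).
Proof.
apply: (uniform_map_transfer (@dyadic_cell_uniform R N)).
  by rewrite card_ffun card_bool !card_ord.
move=> x y; split=> [/ffunP xy|].
  apply: val_inj; apply/eq_dyadic_cell => -[|k] // /andP[_ kN].
  by have := xy (Ordinal kN); rewrite !ffunE.
move=> /(congr1 val)/eq_dyadic_cell xy; apply/ffunP => j.
by rewrite !ffunE xy //=.
Qed.

(** Reading the digits at selected positions is a projection from the words
    formed by all digits up to the last of these positions.  Its fibres are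
    translates of each other for the bitwise sum, so they are equinumerous. *)
Lemma digits_at_uniform (I : finType) (pos : I -> nat) :
  injective pos -> (forall i, 0 < pos i)%N -> uniform_map (lebP R)
    (fun x => [ffun i => digit x (pos i)] : {ffun I -> bool}).
Proof.
move=> pos_inj pos_gt0; pose N := (\max_i pos i)%N.
have posN i : ((pos i).-1 < N)%N by rewrite prednK // leq_bigmax.
pose p i : 'I_N := Ordinal (posN i).
have p_inj : injective p.
  move=> i j /(congr1 val) /= ij; apply: pos_inj.
  by rewrite -(prednK (pos_gt0 i)) ij prednK.
pose g (h : {ffun 'I_N -> bool}) : {ffun I -> bool} := [ffun i => h (p i)].
have -> : (fun x => [ffun i => digit x (pos i)] : {ffun I -> bool}) =
    g \o (fun x : I01 R => [ffun j : 'I_N => digit x j.+1]).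
  by apply/funext => x; apply/ffunP => i; rewrite !ffunE /= prednK.
pose zero : {ffun I -> bool} := [ffun=> false].
apply: (uniform_map_comp (c := #|[set h | g h == zero]%SET|)).
  exact: leading_digits_uniform.
move=> b.
pose e (j : 'I_N) := [exists i, (p i == j) && b i].
have eb i : e (p i) = b i.
  apply/existsP/idP => [[j /andP[/eqP/p_inj -> //]]|bi].
  by exists i; rewrite eqxx.
pose tau (h : {ffun 'I_N -> bool}) : {ffun 'I_N -> bool} := [ffun j => h j (+) e j].
have tauK : involutive tau by move=> h; apply/ffunP => j; rewrite !ffunE addbK.
rewrite -(card_preimset _ (inv_inj tauK)); apply: eq_card => h; rewrite !inE.
apply/eqP/eqP => /ffunP hb; apply/ffunP => i.
  by have := hb i; rewrite !ffunE eb => ->; rewrite addbb.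
by have := hb i; rewrite !ffunE eb => /negbT; rewrite negb_add => /eqP.
Qed.
End DigitsAtPositions.

Section Columns.
Variable M : nat.

(** Rows occupy consecutive intervals of integers, so an entry determines its
    row, and then its column. *)
Lemma row_entry_inj rho rho' i i' : (0 < rho)%N -> (0 < rho')%N ->
  (0 < i <= row_length M rho)%N -> (0 < i' <= row_length M rho')%N ->
  row_entry M rho i = row_entry M rho' i' -> i = i'.
Proof.
have lt r r' j j' : (0 < r)%N -> (0 < j <= row_length M r)%N -> (0 < j')%N ->
    (r < r')%N -> (row_entry M r j < row_entry M r' j')%N.
  move=> r0 /andP[j0 jr] j'0 rr'; rewrite /row_entry.
  rewrite [X in (_ < X + _)%N](@big_cat_nat _ _ _ r) //=; last exact: ltnW.
  by rewrite [X in (_ < _ + X + _)%N]big_ltn //; lia.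
move=> r0 r'0 ir ir' E; case: (ltngtP rho rho') => rr.
- by have := lt _ _ i i' r0 ir (proj1 (andP ir')) rr; rewrite E ltnn.
- by have := lt _ _ i' i r'0 ir' (proj1 (andP ir)) rr; rewrite E ltnn.
- by move: E; rewrite /row_entry rr => /addnI.
Qed.

Lemma column_entry_in i k : (0 < i)%N -> (0 < k)%N ->
  column M i (column_entry M i k).
Proof. by move=> i0 k0; have [_ <-] := column_entryP M i0; exists k. Qed.

Lemma column_entry_gt0 i k : (0 < i)%N -> (0 < k)%N -> (0 < column_entry M i k)%N.
Proof.
move=> i0 k0; have [rho [_ _ ->]] := column_entry_in i0 k0.
by rewrite /row_entry addn_gt0 i0 orbT.
Qed.

Lemma column_entry_inj i i' k k' : (0 < i)%N -> (0 < i')%N ->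
  (0 < k)%N -> (0 < k')%N ->
  column_entry M i k = column_entry M i' k' -> (i, k) = (i', k').
Proof.
move=> i0 i'0 k0 k'0 E.
have [r [r0 ir rE]] := column_entry_in i0 k0.
have [r' [r'0 ir' rE']] := column_entry_in i'0 k'0.
have ii' : i = i'.
  apply: (@row_entry_inj r r') => //; rewrite ?i0 ?i'0 //.
  by rewrite -rE -rE'.
congr (_, _) => //; rewrite -{}ii' in E.
have [inc _] := column_entryP M i0.
case: (ltngtP k k') => // kk.
  by have := inc k k'; rewrite E ltnn k0 kk => /(_ isT).
by have := inc k' k; rewrite E ltnn k'0 kk => /(_ isT).
Qed.

(** Different columns read digits at different positions. *)
Lemma column_digits_uniform (R : realType) (T : finType)
    (sigma : M.+1.-tuple bool -> T) (n : nat) : bijective sigma ->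
  uniform_map (lebP R)
    (fun x => [ffun i : 'I_n => sigma (column_digits M i.+1 x)]
       : {ffun 'I_n -> T}).
Proof.
move=> sigma_bij.
pose pos (ik : 'I_n * 'I_M.+1) := column_entry M ik.1.+1 ik.2.+1.
have pos_inj : injective pos.
  by move=> [i k] [j l] /column_entry_inj -/(_ isT isT isT isT) /=
    [/val_inj -> /val_inj ->].
have pos_gt0 ik : (0 < pos ik)%N by exact: column_entry_gt0.
apply: (uniform_map_transfer (@digits_at_uniform R _ _ pos_inj pos_gt0)).
  rewrite !card_ffun card_bool card_prod !card_ord.
  by rewrite -(bij_eq_card sigma_bij) card_tuple card_bool -expnM mulnC.
move=> x y; split=> /ffunP xy; apply/ffunP => i.
  case: i => i k; have := xy i; rewrite !ffunE => /(bij_inj sigma_bij).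
  by move=> /(congr1 (fun t => tnth t k)); rewrite !tnth_mktuple.
rewrite !ffunE; congr sigma; apply: eq_from_tnth => k; rewrite !tnth_mktuple.
by have := xy (i, k); rewrite !ffunE.
Qed.
End Columns.

(** * The quantile function of a function of a uniform word *)

Section Quantile.
Variables (R : realType) (F : finType) (V : F -> R) (L : nat).
Hypothesis cardF : #|F| = (2 ^ L)%N.

Definition outcomes_by_value : seq F := sort (relpre V <=%R) (enum F).

Lemma size_outcomes_by_value : size outcomes_by_value = (2 ^ L)%N.
Proof. by rewrite size_sort -cardE. Qed.

(** The elements of value at most [t] form an initial segment of the sorted list. *)
Lemma lt_card_le_value f0 j t : (j < 2 ^ L)%N ->
  (j < #|[pred f | (V f <= t)%R]|)%N = (V (nth f0 outcomes_by_value j) <= t).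
Proof.
rewrite -size_outcomes_by_value => jL; set s := outcomes_by_value.
have -> : #|[pred f | V f <= t]| = count (fun f => V f <= t) s.
  rewrite -size_filter cardE; apply/perm_size/uniq_perm.
  - exact: enum_uniq.
  - by rewrite filter_uniq // sort_uniq enum_uniq.
  - by move=> f; rewrite mem_enum mem_filter mem_sort mem_enum andbT inE.
have V_mono i k : (i <= k)%N -> (k < size s)%N -> V (nth f0 s i) <= V (nth f0 s k).
  move=> ik ks; apply: (@sorted_leq_nth _ (relpre V <=%R)) => //.
  - by move=> b a c; exact: le_trans.
  - by move=> a; exact: lexx.
  - by apply: sort_sorted => a b; exact: le_total.
  - by rewrite inE (leq_ltn_trans ik ks).
rewrite -{1}(cat_take_drop j s) (drop_nth f0 jL) count_cat /=.
have [Vt|Vt] := boolP (V (nth f0 s j) <= t).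
  suff -> : count (fun f => V f <= t) (take j s) = j by lia.
  rewrite -[RHS](size_takel (ltnW jL)); apply/eqP; rewrite -all_count.
  apply/(all_nthP f0) => i; rewrite size_takel ?(ltnW jL) // => ij.
  by rewrite nth_take // (le_trans _ Vt) // V_mono // ltnW.
suff -> : count (fun f => V f <= t) (drop j.+1 s) = 0%N.
  rewrite !addn0 ltnNge.
  by rewrite -[X in (_ <= X)%N](size_takel (ltnW jL)) count_size.
apply/eqP; rewrite -leqn0 leqNgt -has_count; apply/hasPn => f.
move=> /(nthP f0)[i]; rewrite size_drop => ilt <-; rewrite nth_drop.
apply: (contra _ Vt) => Vk; apply: le_trans Vk; apply: V_mono.
  by rewrite addSn ltnW // ltnS leq_addr.
by rewrite -ltn_subRL.
Qed.

Variable f0 : F.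

Definition rearranged_outcome (x : I01 R) : F :=
  nth f0 outcomes_by_value (dyadic_cell L x).

Lemma eq_rearranged_outcome x y :
  rearranged_outcome x = rearranged_outcome y <->
  forall k, (0 < k <= L)%N -> digit x k = digit y k.
Proof.
rewrite -eq_dyadic_cell; split=> [/eqP|]; last by rewrite /rearranged_outcome => ->.
rewrite nth_uniq ?sort_uniq ?enum_uniq ?size_outcomes_by_value ?dyadic_cell_lt //.
by move/eqP.
Qed.

Lemma rearranged_outcome_uniform : uniform_map (lebP R) rearranged_outcome.
Proof.
apply: (uniform_map_transfer (@dyadic_cell_uniform R L)).
  by rewrite cardF card_ord.
move=> x y; rewrite eq_rearranged_outcome -eq_dyadic_cell.
by split=> [xy|/(congr1 val)//]; exact: val_inj.
Qed.

(** If [j] is the number of the cell of [x], then [x < c / 2 ^ L] means [j < c]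
    for an integer [c].  With [c] the number of elements of value at most [t],
    this says that the element of rank [j] has value at most [t]; hence the set
    whose infimum is the quantile is a closed half-line starting at that value. *)
Lemma quantile_rearranged (X : {RV (lebP R) >-> R}) (Psi : I01 R -> F) :
  uniform_map (lebP R) Psi -> (forall x, X x = V (Psi x)) ->
  forall x : I01 R, quantile X x = V (rearranged_outcome x).
Proof.
move=> uPsi XV x; rewrite /quantile.
have cdfE t : cdf X t = (#|[pred f | V f <= t]|%:R / 2 ^+ L)%:E.
  rewrite /cdf /distribution /pushforward.
  have -> : X @^-1` `]-oo, t] = [set x | [pred f | V f <= t] (Psi x)].
    by apply/seteqP; split=> y /=; rewrite in_itv /= XV.
  by rewrite uniform_map_prob // cardF natrX.
have -> : [set t | ((I01_val x)%:E < cdf X t)%E] = `[V (rearranged_outcome x), +oo[%classic.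
  have lt_cdf t : ((I01_val x)%:E < cdf X t)%E = (V (rearranged_outcome x) <= t).
    have /andP[x0 _] : 0 < I01_val x < 1 by exact: (svalP x).
    rewrite cdfE lte_fin -lt_card_le_value ?dyadic_cell_lt // /dyadic_cell.
    rewrite truncn_lt_nat ?mulr_ge0 ?exprn_ge0 ?(ltW x0) //.
    by rewrite ltr_pdivlMr ?exprn_gt0 // mulrC.
  by apply/seteqP; split=> t /=; rewrite lt_cdf in_itv /= andbT.
by rewrite inf_itv.
Qed.
End Quantile.

(** * Cardinality of finite sets and of countable products *)

Lemma card_eq_finset (T : finType) (A : {set T}) : [set` A] #= `I_#|A|.
Proof.
have -> : [set` A] = (fun i : 'I_#|A| => enum_val i) @` setT.
  apply/seteqP; split=> [x xA|_ [i _ <-]]; last exact: enum_valP.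
  by exists (enum_rank_in xA x) => //; rewrite enum_rankK_in.
apply: (card_eq_trans (inj_card_eq _)); last by rewrite card_eq_sym card_II.
by move=> i j _ _; exact: enum_val_inj.
Qed.

Lemma card_le_inj T U (A : set T) (f : T -> U) :
  {in A &, injective f} -> A #<= [set: U].
Proof.
move=> fi; apply: (@card_le_trans _ _ _ (f @` A)); last exact: card_leT.
by have := inj_card_eq fi; rewrite card_eq_le => /andP[].
Qed.

(** A zero digit is inserted after each term, so that the expansion has
    infinitely many zeros and is determined by its sum. *)
Lemma binary_sequences_le_real (R : realType) : [set: nat -> bool] #<= [set: R].
Proof.
pose e (b : nat -> bool) k := ~~ odd k && b k./2.-1.
have /choice[x xe] b : exists x : R, binary_expansion x (e b).
  pose u N : R := \sum_(1 <= i < N.+1) (e b i)%:R * 2^-1 ^+ i.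
  have cu : cvgn u.
    apply: nondecreasing_is_cvgn.
      apply/nondecreasing_seqP => N; rewrite /u [leRHS]big_nat_recr //= lerDl.
      by rewrite mulr_ge0 ?exprn_ge0 ?invr_ge0.
    exists 1 => _ [N _ <-]; rewrite /u digit_series_prefix exprVn.
    rewrite ler_pdivrMr ?exprn_gt0 // mul1r -natrX ler_nat.
    by apply: ltnW; exact: dyadic_prefix_lt.
  exists (limn u); split=> // N; exists N.*2.+1; first by lia.
  by rewrite /e /= odd_double.
apply: (@card_le_inj _ _ _ x) => b c _ _ bc; apply/funext => n.
have := binary_expansion_inj (xe b) _ (k := n.+1.*2); rewrite bc => /(_ _ (xe c) isT).
by rewrite /e odd_double doubleK.
Qed.

(** A real number is determined by the rationals below it. *)
Lemma real_le_binary_sequences (R : realType) : [set: R] #<= [set: nat -> bool].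
Proof.
pose cut (x : R) n := if unpickle n is Some q then (ratr q : R) < x else false.
suff lt_cut x y : x < y -> cut x <> cut y.
  apply: (@card_le_inj _ _ _ cut) => x y _ _ xy.
  by case: (ltgtP x y) => // /lt_cut; rewrite xy.
move=> /rat_in_itvoo[q]; rewrite in_itv /= => /andP[xq qy].
move=> /(congr1 (fun f => f (pickle q))); rewrite /cut pickleK qy.
by rewrite ltNge ltW.
Qed.

(** An element of the product is coded by the graph of the sequence of numbers
    of its components. *)
Lemma countable_product_le_binary_sequences (T : nat -> Type)
    (A : forall n, set (T n)) : (forall n, countable (A n)) ->
  [set X : forall n, T n | forall n, A n (X n)] #<= [set: nat -> bool].
Proof.
move=> cA.
have c n : {c : T n -> nat | {in A n &, injective c}}.
  by apply: cid; apply/countable_injP.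
pose code (X : forall n, T n) j :=
  if unpickle j is Some (n, k) then sval (c n) (X n) == k else false.
apply: (@card_le_inj _ _ _ code) => X Y; rewrite !inE /= => AX AY XY.
apply: functional_extensionality_dep => n; apply: (svalP (c n)); rewrite ?inE //.
have := congr1 (fun f => f (pickle (n, sval (c n) (X n)))) XY.
by rewrite /code pickleK eqxx => /esym/eqP.
Qed.

Lemma binary_sequences_le_product (T : nat -> Type) (A : forall n, set (T n)) N :
  (forall n, A n !=set0) ->
  (forall n, (N <= n)%N -> exists a b, [/\ A n a, A n b & a <> b]) ->
  [set: nat -> bool] #<= [set X : forall n, T n | forall n, A n (X n)].
Proof.
move=> A0 A2.
have ab n : {ab : T n * T n | [/\ A n ab.1, A n ab.2 &
    (N <= n)%N -> ab.1 <> ab.2]}.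
  apply: cid; have [Nn|nN] := leqP N n.
    by have [a [b [Aa Ab ab]]] := A2 n Nn; exists (a, b).
  by have [a Aa] := A0 n; exists (a, a); split.
pose F (b : nat -> bool) n := if b (n - N)%N then (sval (ab n)).1 else (sval (ab n)).2.
have Finj : injective F.
  move=> b c bc; apply/funext => n; have := congr1 (fun X => X (n + N)%N) bc.
  have [_ _ /(_ (leq_addl _ _))] := svalP (ab (n + N)%N); rewrite /F addnK.
  by case: (b n); case: (c n) => // + /esym.
apply: (@card_le_trans _ _ _ (F @` setT)).
  have : F @` setT #= [set: nat -> bool] by apply: inj_card_eq => b c _ _ /Finj.
  by rewrite card_eq_le => /andP[].
apply: subset_card_le => _ [b _ <-] n; rewrite /F.
by have [] := svalP (ab n); case: ifP.
Qed.

Lemma countable_product_continuum (R : realType) (T : nat -> Type)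
    (A : forall n, set (T n)) N :
  (forall n, countable (A n)) -> (forall n, A n !=set0) ->
  (forall n, (N <= n)%N -> exists a b, [/\ A n a, A n b & a <> b]) ->
  [set X : forall n, T n | forall n, A n (X n)] #= [set: R].
Proof.
move=> cA A0 A2; rewrite card_eq_le; apply/andP; split.
  apply: (card_le_trans (countable_product_le_binary_sequences cA)).
  exact: binary_sequences_le_real.
apply: (card_le_trans (real_le_binary_sequences R)).
exact: binary_sequences_le_product A2.
Qed.

(** * Independent uniform rows and permutations of words *)

Section UniformRows.
Context d (S : measurableType d) (R : realType) (P : probability S R).
Variables (n : nat) (T : finType) (Psi : S -> {ffun 'I_n -> T}).
Hypothesis uPsi : uniform_map P Psi.

Lemma card_ffun_constrained (J : {set 'I_n}) (A : 'I_n -> pred T) :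
  #|[pred f : {ffun 'I_n -> T} | [forall i in J, A i (f i)]]| =
  (\prod_i (if i \in J then #|A i| else #|T|))%N.
Proof.
pose F i : pred T := if i \in J then A i else predT.
transitivity (\prod_(i : 'I_n) #|F i|)%N; last first.
  by apply: eq_bigr => i _; rewrite /F; case: ifP.
have <- : foldr muln 1%N [seq #|F i| | i : 'I_n] = (\prod_(i : 'I_n) #|F i|)%N.
  by rewrite foldrE big_map big_enum.
have /= <- := card_family F; apply: eq_card => f; rewrite !inE.
apply: eq_forallb => i; rewrite -[RHS]/(F i (f i)) /F.
by case: (i \in J).
Qed.

Lemma uniform_coordinate i : uniform_map P (fun x => Psi x i).
Proof.
apply: (uniform_map_comp (Phi := Psi) (g := fun f => f i)
  (c := (\prod_(j | j != i) #|T|)%N)) => // t.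
have := card_ffun_constrained [set i] (fun _ => pred1 t).
rewrite (bigD1 i) //= inE eqxx card1 mul1n.
rewrite (eq_bigr (fun=> #|T|)) => [<-|j /negbTE ji]; last by rewrite inE ji.
apply: eq_card => f; rewrite !inE; apply/idP/forallP => [fi j|/(_ i)].
  by apply/implyP; rewrite inE => /eqP ->.
by rewrite inE eqxx.
Qed.

(** Constraints on separate coordinates of a word can be met independently, so
    counting the words that satisfy them gives a product. *)
Lemma uniform_coordinates_prod (J : {set 'I_n}) (A : 'I_n -> pred T) :
  P [set x | [forall i in J, A i (Psi x i)]] =
  (\prod_(i in J) P [set x | A i (Psi x i)])%E.
Proof.
rewrite (uniform_map_prob [pred f : {ffun 'I_n -> T} | [forall i in J, A i (f i)]] uPsi).
under [RHS]eq_bigr do rewrite (uniform_map_prob (A _) (uniform_coordinate _)).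
rewrite prodEFin card_ffun_constrained card_ffun card_ord; congr (_%:E).
(* When [n = 0] the type [T] may be empty, but the product is too. *)
have T0 : (0 < n)%N -> #|T|%:R != 0 :> R.
  move=> n0; rewrite pnatr_eq0 -lt0n.
  by rewrite (uniform_map_card_gt0 P (fun x => Psi x (Ordinal n0))).
rewrite natrX -[X in _ ^+ X]card_ord -prodr_const natr_prod -prodf_div.
rewrite [RHS]big_mkcond; apply: eq_bigr => i _; case: ifP => // _.
by rewrite divff // T0 // (leq_ltn_trans (leq0n i)).
Qed.

End UniformRows.

Section TrimRows.
Variables (R : realType) (M : nat) (o : 'I_(2 ^ M.+1) -> R) (n : nat).
Hypothesis o_inj : injective o.
Hypothesis o_mean : \sum_s o s = 0.
Hypothesis o_var : \sum_s o s ^+ 2 = (2 ^ M.+1)%:R.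
Local Notation F := {ffun 'I_n -> 'I_(2 ^ M.+1)}.
Local Notation P := (lebP R).

Lemma uniform_trim_row (S : I01 R -> R) (X : 'I_n -> {RV P >-> R})
    (Psi : I01 R -> F) :
  uniform_map P Psi -> depends_only_on_digits (n * M.+1) Psi ->
  (forall x, S x = outcome_sum o (Psi x)) -> (forall i x, X i x = o (Psi x i)) ->
  trim_row o S X.
Proof.
move=> uPsi dPsi SPsi XPsi.
have XE i : X i = o \o (fun x => Psi x i) :> (I01 R -> R).
  by apply/funext => x; rewrite XPsi.
have uX i := uniform_coordinate uPsi i.
have preimX i (B : set R) :
    X i @^-1` B = [set x | [pred s | o s \in B] (Psi x i)].
  by apply/seteqP; split=> x /=; rewrite inE XPsi.
have m0 : (2 ^ M.+1)%:R != 0 :> R by rewrite pnatr_eq0 expn_eq0.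
split.
- split=> [J B mB|i j B mB].
    have -> : \bigcap_(i in [set` J]) (X i @^-1` B i) =
        [set x | [forall i in J, [pred s | o s \in B i] (Psi x i)]].
      apply/seteqP; split=> x /= h.
        by apply/forall_inP => i iJ; rewrite inE -XPsi; exact: h.
      move=> i iJ /=; move/forall_inP: h => /(_ i iJ) /=.
      by rewrite inE -XPsi.
    rewrite (uniform_coordinates_prod uPsi J (fun i => [pred s | o s \in B i])).
    by apply: eq_bigr => i _; rewrite preimX.
  rewrite /distribution /pushforward !preimX.
  by rewrite !(uniform_map_prob _ (uX _)).
- by move=> i x y xy; rewrite !XPsi (dPsi x y).
- move=> i.
  have E0 : ('E_P[X i] = 0)%E.
    by rewrite XE (uniform_map_expectation o (uX i)) o_mean mul0r.
  split=> //; rewrite /variance unlock E0 /=.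
  rewrite (_ : _ * _ = (fun s => o s ^+ 2) \o (fun x => Psi x i)); last first.
    apply/funext => x; rewrite -[LHS]/((X i x - 0) * (X i x - 0)).
    by rewrite subr0 XPsi /= expr2.
  by rewrite (uniform_map_expectation _ (uX i)) o_var card_ord divff.
- move=> i; split.
    apply/seteqP; split=> [_ [x _ <-]|_ [s _ <-]].
      by exists (Psi x i) => //; rewrite XPsi.
    by have [x <-] := uniform_map_surj (uX i) s; exists x => //; rewrite XPsi.
  move=> s; rewrite preimX (uniform_map_prob _ (uX i)) card_ord.
  suff /eq_card -> : [pred t | o t \in [set o s]] =i pred1 s by rewrite card1 mul1r.
  by move=> t; rewrite !inE; apply/idP/eqP => [|->]; rewrite ?inE // => /o_inj.
- by move=> x; rewrite SPsi; apply: eq_bigr => i _; rewrite XPsi.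
Qed.

(** Injectivity of [o] lets one read the values of a row as a word.  A prescribed
    word then has probability [(2 ^ M.+1) ^- n], the product of the probabilities of its
    letters. *)
Lemma trim_row_uniform (S : I01 R -> R) (X : 'I_n -> {RV P >-> R}) :
  trim_row o S X ->
  exists Psi : I01 R -> F,
    [/\ uniform_map P Psi, depends_only_on_digits (n * M.+1) Psi &
        forall i x, X i x = o (Psi x i)].
Proof.
move=> [[indX _] dX _ unifX _].
have /choice[Psi PsiE] x : exists f : F, forall i, X i x = o (f i).
  have /choice[f fE] i : exists s, X i x = o s.
    have [rX _] := unifX i; have : range (X i) (X i x) by exists x.
    by rewrite rX => -[s _ <-]; exists s.
  by exists [ffun i => f i] => i; rewrite ffunE fE.
exists Psi; split=> [f|x y xy|i x]; last exact: PsiE.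
  have fE : Psi @^-1` [set f] = \bigcap_(i in [set` [set: 'I_n]%SET]) (X i @^-1` [set o (f i)]).
    apply/seteqP; split=> x /= => [<- i _ /=|h]; first exact: PsiE.
    apply/ffunP => i; apply: o_inj; rewrite -PsiE.
    by apply: (h i); rewrite /= finset.in_setT.
  split.
    rewrite fE; apply: fin_bigcap_measurable => [|i _]; first exact: finite_finset.
    exact: measurable_funPTI.
  rewrite fE (indX [set: 'I_n]%SET (fun i => [set o (f i)])); last first.
    by move=> i; exact: measurable_set1.
  rewrite (eq_bigr (fun=> ((2 ^ M.+1)%:R^-1)%:E)); last first.
    by move=> i _; rewrite (unifX i).2.
  rewrite prodEFin prodr_const cardsT card_ord card_ffun !card_ord.
  by rewrite exprVn -natrX.
by apply/ffunP => i; apply: o_inj; rewrite -!PsiE; exact: dX.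
Qed.

Variables (S : I01 R -> R) (Phi : I01 R -> F).
Hypothesis uPhi : uniform_map P Phi.
Hypothesis eq_Phi : forall x y, Phi x = Phi y <->
  forall k, (0 < k <= n * M.+1)%N -> digit x k = digit y k.
Hypothesis SPhi : forall x, S x = outcome_sum o (Phi x).

Definition permuted_row (p : {perm F}) (i : 'I_n) : {RV P >-> R} :=
  uniform_rv uPhi (fun f => o (p f i)).

Lemma permuted_row_inj : injective permuted_row.
Proof.
move=> p q pq; apply/permP => f; have [x <-] := uniform_map_surj uPhi f.
apply/ffunP => i; apply: o_inj.
by have := congr1 (fun X : 'I_n -> {RV P >-> R} => X i x) pq.
Qed.

(** As [Psi] is constant on the cells, it factors as [g \o Phi], where [g] is onto
    the finite set of words, hence a permutation. *)
Lemma trim_row_permuted X : trim_row o S X <->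
  exists2 p, p \in colour_perms (@outcome_sum R _ o n) & permuted_row p = X.
Proof.
split=> [trX|[p /colour_permsP pK <-]]; last first.
  apply: (@uniform_trim_row _ _ (p \o Phi)).
  - apply: (uniform_map_transfer uPhi) => // x y.
    by split=> [/perm_inj|/= ->].
  - by move=> x y xy /=; congr (p _); apply/eq_Phi.
  - by move=> x; rewrite /= pK SPhi.
  - by [].
have [Psi [uPsi dPsi XPsi]] := trim_row_uniform trX.
have [xs xsP] := choice (uniform_map_surj uPhi).
have [ys ysP] := choice (uniform_map_surj uPsi).
pose g f := Psi (xs f); pose h f := Phi (ys f).
have PsiE x : Psi x = g (Phi x).
  by apply: dPsi; apply/eq_Phi; rewrite xsP.
(* A right inverse of [g] is injective, hence a bijection of a finite set. *)
have hK : cancel h g by move=> f; rewrite /h -PsiE ysP.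
have gK : cancel g h by apply: (bij_can_sym (injF_bij (can_inj hK)) _).2.
exists (perm (can_inj gK)); last first.
  apply/funext => i; apply/mfuneqP => x.
  by rewrite uniform_rvE permE -PsiE XPsi.
apply/colour_permsP => f; have [x <-] := uniform_map_surj uPhi f.
rewrite permE -PsiE -SPhi; have [_ _ _ _ ->] := trX.
by apply: eq_bigr => i _; rewrite XPsi.
Qed.

Lemma card_trim_rows : [set X : 'I_n -> {RV P >-> R} | trim_row o S X] #=
  `I_#|colour_perms (@outcome_sum R _ o n)|.
Proof.
have -> : [set X : 'I_n -> {RV P >-> R} | trim_row o S X] =
    permuted_row @` [set` colour_perms (@outcome_sum R _ o n)].
  apply/seteqP; split=> X /= => [/trim_row_permuted[p pK <-]|[p pK <-]].
    by exists p.
  by apply/trim_row_permuted; exists p.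
apply: card_eq_trans (card_eq_finset _); apply: inj_card_eq.
by move=> p q _ _; exact: permuted_row_inj.
Qed.

(** Exchanging the first two letters of every word preserves the values of the
    words; it is not the identity because there are at least two outcomes. *)
Lemma two_trim_rows : (1 < n)%N ->
  exists X Y : 'I_n -> {RV P >-> R}, [/\ trim_row o S X, trim_row o S Y & X <> Y].
Proof.
move=> n1; pose i0 := Ordinal (ltnW n1); pose i1 := Ordinal n1.
pose swap (f : F) : F := [ffun i => f (tperm i0 i1 i)].
have swapK : involutive swap.
  by move=> f; apply/ffunP => i; rewrite !ffunE tpermK.
exists (permuted_row 1%g), (permuted_row (perm (inv_inj swapK))); split.
- apply/trim_row_permuted; exists 1%g => //.
  by apply/colour_permsP => f; rewrite perm1.
- apply/trim_row_permuted; eexists; last by [].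
  apply/colour_permsP => f; rewrite permE /outcome_sum.
  rewrite [RHS](reindex_inj (@perm_inj _ (tperm i0 i1))) /=.
  by apply: eq_bigr => i _; rewrite ffunE.
have m1 : (1 < 2 ^ M.+1)%N by rewrite -[1%N](expn0 2) ltn_exp2l.
pose f : F := [ffun i => if i == i0 then Ordinal (ltnW m1) else Ordinal m1].
move=> /permuted_row_inj/permP/(_ f); rewrite perm1 permE => /ffunP/(_ i0).
by rewrite !ffunE eqxx tpermL.
Qed.

End TrimRows.

(** * Counting the representations *)

Theorem corollary2 (R : realType) (M : nat)
    (O : {RV (lebP R) >-> R})
    (o : 'I_(2 ^ M.+1) -> R)
    (varsigma : 'I_(2 ^ M.+1) -> M.+1.-tuple bool)
    (Rv : nat -> {RV (lebP R) >-> R})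
    (hbij : depends_bijectively_on_digits M.+1 O)
    (hincr : forall s t : 'I_(2 ^ M.+1), (s < t)%N -> o s < o t)
    (hunif : uniform_on_outcomes o O)
    (hmean : \sum_s o s = 0)
    (hvar : \sum_s o s ^+ 2 = (2 ^ M.+1)%:R)
    (hvarsigma : forall x s, O x = o s <-> first_digits M.+1 x = varsigma s)
    (hRv : forall i, (0 < i)%N -> forall x s,
       Rv i x = o s <-> column_digits M i x = varsigma s) :
  let Sstar (n : nat) (x : I01 R) := quantile (partial_sum Rv n) x in
  (forall n, (0 < n)%N ->
     [set X : 'I_n -> {RV (lebP R) >-> R} | trim_row o (Sstar n) X] #=
     `I_(\prod_(0 <= t < (last_index o n).+1) (gamma_ o n t)`!)) /\
  ([set X : forall n, 'I_n -> {RV (lebP R) >-> R} | trim_array o Sstar X] #=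
     [set: R]).
Proof.
move=> Sstar.
have o_inj : injective o.
  move=> s t st; apply: val_inj.
  by case: (ltngtP s t) => // /hincr; rewrite st ltxx.
have varsigma_inj : injective varsigma.
  move=> s t st; apply: o_inj.
  have [x _ xs] : range O (o s) by rewrite hunif.1; exists s.
  by rewrite -xs; apply/hvarsigma; rewrite -st; apply/hvarsigma.
have [sigma varsigmaK sigmaK] : bijective varsigma.
  by apply: inj_card_bij; rewrite // card_tuple card_bool card_ord.
pose Psi n (x : I01 R) : {ffun 'I_n -> 'I_(2 ^ M.+1)} :=
  [ffun i : 'I_n => sigma (column_digits M i.+1 x)].
have uPsi n : uniform_map (lebP R) (Psi n).
  by apply: column_digits_uniform; exists varsigma.
(* The columns are numbered from 1, the letters of a word from 0. *)
have sumPsi n x : partial_sum Rv n x = outcome_sum o (Psi n x).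
  rewrite /partial_sum /outcome_sum big_add1 big_mkord /= mfun_sum.
  by apply: eq_bigr => i _; rewrite /Psi ffunE; apply/hRv.
have cardF n : #|{ffun 'I_n -> 'I_(2 ^ M.+1)}| = (2 ^ (n * M.+1))%N.
  by rewrite card_ffun !card_ord mulnC expnM.
pose Phi n := rearranged_outcome (@outcome_sum R _ o n) (n * M.+1) (Psi n point).
have uPhi n : uniform_map (lebP R) (Phi n) by exact: rearranged_outcome_uniform.
have eqPhi n x y : Phi n x = Phi n y <->
    forall k, (0 < k <= n * M.+1)%N -> digit x k = digit y k.
  exact: eq_rearranged_outcome.
have SPhi n x : Sstar n x = outcome_sum o (Phi n x).
  exact: (quantile_rearranged (cardF n) _ (uPsi n) (sumPsi n)).
have card_rows n : [set X : 'I_n -> {RV (lebP R) >-> R} | trim_row o (Sstar n) X] #=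
     `I_(\prod_(0 <= t < (last_index o n).+1) (gamma_ o n t)`!).
  rewrite -(card_sum_preserving_perms o (Phi n point)).
  exact: (card_trim_rows o_inj hmean hvar (uPhi n) (@eqPhi n) (SPhi n)).
split=> [n _ //|].
pose A n : set ('I_n -> {RV (lebP R) >-> R}) :=
  [set X | (0 < n)%N -> trim_row o (Sstar n) X].
have AE n : (0 < n)%N -> A n = [set X | trim_row o (Sstar n) X].
  by move=> n0; apply/seteqP; split=> X /= => [/(_ n0)|trX _].
(* There is a single family of variables indexed by ['I_0]. *)
have A0E : A 0%N = [set (fun i : 'I_0 => O)].
  apply/seteqP; split=> [X _|X _]; last by rewrite /A.
  by apply/funext => -[].
have A2 n : (1 < n)%N -> exists X Y, [/\ A n X, A n Y & X <> Y].
  move=> n1; have [X [Y [trX trY XY]]] :=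
    two_trim_rows o_inj hmean hvar (uPhi n) (@eqPhi n) (SPhi n) n1.
  by exists X, Y; split.
apply: (@countable_product_continuum R _ A 2) => //.
- case=> [|n]; first by rewrite A0E; exact: countable1.
  rewrite AE //; apply: finite_set_countable; apply/finite_setP.
  by eexists; exact: card_rows.
- move=> n; exists (permuted_row o (uPhi n) 1%g) => _.
  apply/(trim_row_permuted o_inj hmean hvar (uPhi n) (@eqPhi n) (SPhi n)).
  by exists 1%g => //; apply/colour_permsP => f; rewrite perm1.
Qed.
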